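(* Let $R$ be a ring with a compatible endomorphism $\alpha$. Then the following statements are equivalent: (i) $R$ is right $\mathfrak{cP}$-Baer; (ii) the skew polynomial ring $R[x;\alpha]$ is right $\mathfrak{cP}$-Baer; (iii) the skew power series ring $R[[x;\alpha]]$ is right $\mathfrak{cP}$-Baer.
   Context: All rings are associative with identity (not necessarily commutative). For a subset $S$ of a ring $R$, $r_R(S)=\{a\in R : sa=0 \text{ for all } s\in S\}$. A ring $R$ is right $\mathfrak{cP}$-Baer if for every idempotent $e=e^2\in R$ there is an idempotent $c=c^2\in R$ with $r_R(eR)=cR$ (equivalently, the right annihilator in $R$ of every cyclic projective right $R$-module is generated by an idempotent as a right ideal). A ring endomorphism $\alpha$ of $R$ is compatible (and $R$ is $\alpha$-compatible) if for all $a,b\in R$: $ab=0$ if and only if $a\alpha(b)=0$. $R[x;\alpha]$ consists of polynomials $\sum_{i=0}^m a_ix^i$ with coefficients $a_i\in R$ on the left, with usual addition and multiplication determined by $xa=\alpha(a)x$ for $a\in R$. $R[[x;\alpha]]$ consists of formal series $\sum_{i=0}^\infty a_ix^i$, $a_i\in R$, with usual addition and multiplication determined by $xa=\alpha(a)x$. *)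

(* Defs.v *)
From HB Require Import structures.
From mathcomp Require Import all_boot all_algebra.
From mathcomp Require Import boolp classical_sets.

Set Implicit Arguments.
Unset Strict Implicit.
Unset Printing Implicit Defensive.

Import GRing.Theory.
Local Open Scope classical_set_scope.
Local Open Scope ring_scope.

Section CPBaer.
Variable A : pzRingType.

Definition idempotent_elt (e : A) : Prop := e * e = e.

Definition right_annihilator (S : set A) : set A :=
  [set a | forall s, S s -> s * a = 0].

Definition principal_right_ideal (c : A) : set A := [set c * a | a in setT].

Definition right_cP_Baer : Prop :=
  forall e : A, idempotent_elt e ->
  exists2 c : A, idempotent_elt c &
    right_annihilator (principal_right_ideal e) = principal_right_ideal c.

End CPBaer.

Arguments right_cP_Baer A : clear implicits.

Definition compatible (R : pzRingType) (alpha : {rmorphism R -> R}) : Prop :=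
  forall a b : R, a * b = 0 <-> a * alpha b = 0.

Section IterMorphism.
Variables (R : pzRingType) (alpha : {rmorphism R -> R}) (n : nat).

Fact iter_is_zmod_morphism : zmod_morphism (iter n alpha).
Proof. by move=> x y; elim: n => //= k ->; rewrite rmorphB. Qed.

Fact iter_is_monoid_morphism : monoid_morphism (iter n alpha).
Proof.
split=> [|x y]; first by elim: n => //= k ->; rewrite rmorph1.
by elim: n => //= k ->; rewrite rmorphM.
Qed.

HB.instance Definition _ :=
  GRing.isZmodMorphism.Build R R (iter n alpha) iter_is_zmod_morphism.
HB.instance Definition _ :=
  GRing.isMonoidMorphism.Build R R (iter n alpha) iter_is_monoid_morphism.

End IterMorphism.

(* The ring R[[x; alpha]]: [SkewSeries alpha a] is the formal series whose
   coefficient of x^i, written on the left of x^i, is [a i]. *)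
Record skew_series (R : pzRingType) (alpha : {rmorphism R -> R}) :=
  SkewSeries { coefs : nat -> R }.

Arguments SkewSeries {R} alpha _.

Section SkewSeriesRing.
Variables (R : pzRingType) (alpha : {rmorphism R -> R}).
Local Notation series := (skew_series alpha).
Implicit Types f g h : series.

HB.instance Definition _ := gen_eqMixin series.
HB.instance Definition _ := gen_choiceMixin series.

Lemma skew_seriesP f g : coefs f =1 coefs g -> f = g.
Proof. by case: f g => [a] [b] /= /funext ->. Qed.

Definition skew_zero : series := SkewSeries alpha (fun=> 0).
Definition skew_opp f : series := SkewSeries alpha (fun i => - coefs f i).
Definition skew_add f g : series :=
  SkewSeries alpha (fun i => coefs f i + coefs g i).

Definition skew_const (a : R) : series :=
  SkewSeries alpha (fun i => if i == 0%N then a else 0).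

(* (a x^i) (b x^j) = a alpha^i(b) x^(i + j), as forced by x b = alpha(b) x *)
Definition skew_mul f g : series :=
  SkewSeries alpha
    (fun n => \sum_(i < n.+1) coefs f i * iter i alpha (coefs g (n - i))).

Fact skew_addA : associative skew_add.
Proof. by move=> f g h; apply: skew_seriesP => i /=; rewrite addrA. Qed.

Fact skew_addC : commutative skew_add.
Proof. by move=> f g; apply: skew_seriesP => i /=; rewrite addrC. Qed.

Fact skew_add0 : left_id skew_zero skew_add.
Proof. by move=> f; apply: skew_seriesP => i /=; rewrite add0r. Qed.

Fact skew_addN : left_inverse skew_zero skew_opp skew_add.
Proof. by move=> f; apply: skew_seriesP => i /=; rewrite addNr. Qed.

HB.instance Definition _ :=
  GRing.isZmodule.Build series skew_addA skew_addC skew_add0 skew_addN.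

Fact skew_coefM_rev f g n :
  coefs (skew_mul f g) n =
    \sum_(i < n.+1) coefs f (n - i) * iter (n - i) alpha (coefs g i).
Proof.
rewrite /= (reindex_inj rev_ord_inj) /=.
by apply: eq_bigr => i _; rewrite subSS subKn // -ltnS.
Qed.

Fact skew_mulA : associative skew_mul.
Proof.
move=> f g h; apply: skew_seriesP => n; rewrite [RHS]skew_coefM_rev [LHS]/=.
pose coef3 j k := coefs f j * (iter j alpha (coefs g (n - j - k)) *
  iter (n - k) alpha (coefs h k)).
transitivity (\sum_(j < n.+1) \sum_(k < n.+1 | (k <= n - j)%N) coef3 j k).
  apply: eq_bigr => j _; rewrite -/(skew_mul g h).
  have -> : \sum_(i < (n - j).+1) coefs g i * iter i alpha (coefs h (n - j - i))
    = coefs (skew_mul g h) (n - j) by [].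
  rewrite skew_coefM_rev rmorph_sum big_distrr /=.
  rewrite (big_ord_narrow_leq (leq_subr _ _)); apply: eq_bigr => k _ /=.
  rewrite rmorphM /= -iterD /coef3 /=; congr (_ * (_ * iter _ _ _)).
  have := ltn_ord j; have := ltn_ord k; rewrite !ltnS => lek lej.
  rewrite subnAC subnKC // leq_subRL; first by rewrite addnC -leq_subRL.
  exact: leq_trans lek (leq_subr _ _).
rewrite (exchange_big_dep predT) //=; apply: eq_bigr => k _.
transitivity (\sum_(j < n.+1 | (j <= n - k)%N) coef3 j k).
  apply: eq_bigl => j; rewrite -ltnS -(ltnS j) -!subSn ?leq_ord //.
  by rewrite -subn_gt0 -(subn_gt0 j) -!subnDA addnC.
rewrite (big_ord_narrow_leq (leq_subr _ _)) big_distrl /=.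
by apply: eq_bigr => j _; rewrite /coef3 -!subnDA addnC mulrA.
Qed.

Fact skew_mul1l : left_id (skew_const 1) skew_mul.
Proof.
move=> f; apply: skew_seriesP => n /=; rewrite big_ord_recl /= subn0 mul1r.
by rewrite big1 ?addr0 // => i _; rewrite mul0r.
Qed.

Fact skew_mul1r : right_id (skew_const 1) skew_mul.
Proof.
move=> f; apply: skew_seriesP => n.
rewrite skew_coefM_rev big_ord_recl /= subn0 rmorph1 mulr1.
by rewrite big1 ?addr0 // => i _; rewrite rmorph0 mulr0.
Qed.

Fact skew_mulDl : left_distributive skew_mul skew_add.
Proof.
move=> f g h; apply: skew_seriesP => n /=; rewrite -big_split /=.
by apply: eq_bigr => i _; rewrite mulrDl.
Qed.

Fact skew_mulDr : right_distributive skew_mul skew_add.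
Proof.
move=> f g h; apply: skew_seriesP => n /=; rewrite -big_split /=.
by apply: eq_bigr => i _; rewrite rmorphD mulrDr.
Qed.

HB.instance Definition _ := GRing.Zmodule_isPzRing.Build series
  skew_mulA skew_mul1l skew_mul1r skew_mulDl skew_mulDr.

Definition skew_X : series := SkewSeries alpha (fun i => (i == 1%N)%:R).

Lemma skew_mulXC (a : R) : skew_X * skew_const a = skew_const (alpha a) * skew_X.
Proof.
apply: skew_seriesP => -[|[|n]] /=.
- by rewrite !big_ord1 mul0r mulr0.
- by rewrite !big_ord_recl !big_ord0 /= !(mul0r, mul1r, mulr1, add0r, addr0).
rewrite !big1 // => i _; case: i => -[|[|i]] //= _; rewrite ?mul0r ?mulr0 //.
by rewrite rmorph0 mulr0.
Qed.

(* The skew polynomials, as a subring of R[[x; alpha]] *)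
Definition finite_support : {pred series} :=
  [pred f | `[< exists n, forall i, (n <= i)%N -> coefs f i = 0 >]].

Lemma finite_supportP f :
  reflect (exists n, forall i, (n <= i)%N -> coefs f i = 0)
          (f \in finite_support).
Proof. exact: asboolP. Qed.

Fact finite_support_subring : subring_closed finite_support.
Proof.
split=> [|f g /finite_supportP[m f0] /finite_supportP[n g0]
        |f g /finite_supportP[m f0] /finite_supportP[n g0]].
- by apply/finite_supportP; exists 1%N => -[].
- apply/finite_supportP; exists (maxn m n) => i; rewrite geq_max => /andP[mi ni].
  by rewrite [LHS]/= f0 // g0 // subr0.
apply/finite_supportP; exists (m + n)%N => k mnk.
rewrite [LHS]/= big1 // => i _; have [mi|im] := leqP m i.
  by rewrite f0 ?mul0r.
rewrite g0 ?rmorph0 ?mulr0 // leq_subRL; last by rewrite -ltnS.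
by apply: leq_trans mnk; rewrite leq_add2r ltnW.
Qed.

HB.instance Definition _ :=
  GRing.isSubringClosed.Build series finite_support finite_support_subring.

Lemma skew_const_poly a : skew_const a \in finite_support.
Proof. by apply/finite_supportP; exists 1%N => -[]. Qed.

Lemma skew_X_poly : skew_X \in finite_support.
Proof. by apply/finite_supportP; exists 2 => -[|[]]. Qed.

End SkewSeriesRing.

Arguments finite_support {R} alpha _.

(* The ring R[x; alpha] *)
Record skew_poly (R : pzRingType) (alpha : {rmorphism R -> R}) := SkewPoly {
  skew_poly_series :> skew_series alpha;
  _ : skew_poly_series \in finite_support alpha }.

Section SkewPolyRing.
Variables (R : pzRingType) (alpha : {rmorphism R -> R}).

HB.instance Definition _ := [isSub for @skew_poly_series R alpha].
HB.instance Definition _ := [Choice of skew_poly alpha by <:].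
HB.instance Definition _ :=
  GRing.SubChoice_isSubPzRing.Build (skew_series alpha) (finite_support alpha)
    (skew_poly alpha) (finite_support_subring alpha).

End SkewPolyRing.

(* Main.v *)
(* Both skew rings are rings [A] with [R <= A <= R[[x; alpha]]].  An idempotent
   [E] of [A] and its constant term [e] satisfy [r_A(E A) = r_A(e A)]: the
   element [u = e E + (1 - e)(1 - E)] has constant term 1, hence is left
   regular, and [e u = u E], so [e u s f = 0] gives [E s f = 0]; the other
   inclusion is symmetric.  By compatibility, [f] lies in [r_A(e A)] iff all
   its coefficients lie in [r_R(e R)].  So if [r_R(e R) = c R] then
   [r_A(e A) = c A], and if [r_A(e A) = C A] then the constant term of [C]
   generates [r_R(e R)]. *)
Require Import Defs.
From mathcomp Require Import all_boot all_algebra.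
From mathcomp Require Import boolp classical_sets.

Set Implicit Arguments.
Unset Strict Implicit.
Unset Printing Implicit Defensive.

Import GRing.Theory.
Local Open Scope ring_scope.

Section Annihilators.
Variable A : pzRingType.
Implicit Types a c e f s : A.

Lemma right_annihilator_principal e a :
  right_annihilator (principal_right_ideal e) a <-> forall s, e * s * a = 0.
Proof.
split=> [ann s|ann _ [s _ <-]]; last exact: ann.
by apply: ann; exists s.
Qed.

Lemma principal_right_ideal_idempotent c a : idempotent_elt c ->
  principal_right_ideal c a <-> c * a = a.
Proof.
move=> cc; split=> [[b _ <-]|<-]; last by exists a.
by rewrite mulrA cc.
Qed.

(** As [c] is idempotent, membership in [c A] becomes the equation [c * a = a], which can be tested
    coefficientwise. *)
Lemma right_cP_BaerP : right_cP_Baer A <->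
  forall e, idempotent_elt e -> exists2 c, idempotent_elt c &
    forall a, (forall s, e * s * a = 0) <-> c * a = a.
Proof.
split=> baer e ee; have [c cc annc] := baer e ee; exists c => //.
  move=> a; rewrite -right_annihilator_principal annc.
  exact: principal_right_ideal_idempotent.
apply/seteqP; split=> a.
  move/right_annihilator_principal/annc.
  by move/(principal_right_ideal_idempotent _ cc).
move/(principal_right_ideal_idempotent _ cc)/annc.
by move/right_annihilator_principal.
Qed.

Lemma annihilator_idempotent_sub e f a :
    idempotent_elt e -> idempotent_elt f ->
    (forall b, (e * f + (1 - e) * (1 - f)) * b = 0 -> b = 0) ->
  (forall s, e * s * a = 0) -> forall s, f * s * a = 0.
Proof.
move=> ee ff; set u := _ + _ => u_reg ann s.
have eu : e * u = e * f.
  by rewrite mulrDr !mulrA [e * (1 - e)]mulrBr mulr1 ee subrr mul0r addr0.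
have uf : u * f = e * f.
  by rewrite mulrDl -!mulrA ff [(1 - f) * f]mulrBl mul1r ff subrr mulr0 addr0.
(* [u * (f * s * a) = e * (u * s) * a], so [ann] is used at [u * s]. *)
by apply: u_reg; rewrite !mulrA uf -eu -(mulrA e); apply: ann.
Qed.

End Annihilators.

Section SkewSeries.
Variables (R : pzRingType) (alpha : {rmorphism R -> R}).
Implicit Types f g : skew_series alpha.

Lemma coefsD f g i : coefs (f + g) i = coefs f i + coefs g i.
Proof. by []. Qed.

Lemma coefsN f i : coefs (- f) i = - coefs f i.
Proof. by []. Qed.

Lemma coefs1 i : coefs (1 : skew_series alpha) i = if i == 0%N then 1 else 0.
Proof. by []. Qed.

Lemma coefsM f g n : coefs (f * g) n =
  \sum_(i < n.+1) coefs f i * iter i alpha (coefs g (n - i)).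
Proof. by []. Qed.

Lemma coefsM0 f g : coefs (f * g) 0 = coefs f 0 * coefs g 0.
Proof. by rewrite coefsM big_ord1. Qed.

Lemma coefs_constM a f n : coefs (skew_const alpha a * f) n = a * coefs f n.
Proof.
rewrite coefsM big_ord_recl /= subn0 big1 ?addr0 // => i _.
by rewrite mul0r.
Qed.

Lemma skew_const_idempotent a :
  idempotent_elt a -> idempotent_elt (skew_const alpha a).
Proof.
move=> aa; apply: skew_seriesP => -[|n]; rewrite coefs_constM //=.
exact: mulr0.
Qed.

(** Strong induction on [n]: the coefficient of [x^n] in [f * g] is [coefs g n] plus terms
    containing [iter i alpha (coefs g (n - i))] with [0 < i], which vanish by induction. *)
Lemma skew_series_lregular f g : coefs f 0 = 1 -> f * g = 0 -> g = 0.
Proof.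
move=> f0 fg0; apply: skew_seriesP => n; rewrite [RHS]/=.
elim/ltn_ind: n => n IHn.
have /= := congr1 (fun h => coefs h n) fg0.
rewrite big_ord_recl /= subn0 f0 mul1r big1 ?addr0 // => i _.
rewrite IHn ?rmorph0 ?mulr0 //.
rewrite /bump /= add1n; case: n i {IHn} => [[]//|n] i.
by rewrite subSS ltnS leq_subr.
Qed.

Hypothesis alpha_compat : compatible alpha.

Lemma compatible_iter n (a b : R) : a * b = 0 -> a * iter n alpha b = 0.
Proof. by move=> ab0; elim: n => //= n /alpha_compat. Qed.

Section IntermediateRing.
(** [phi] and [iota] stand for the inclusions of [A] in the series ring and of [R] in [A];
    identities in [A] are checked after applying the injective [phi]. *)
Variables (A : pzRingType) (phi : {rmorphism A -> skew_series alpha}).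
Variable iota : R -> A.
Hypothesis phi_inj : injective phi.
Hypothesis phi_iota : forall a, phi (iota a) = skew_const alpha a.
Implicit Types (x y : A) (e c : R).

Let coef0 x := coefs (phi x) 0.

Lemma coef0_idempotent x : idempotent_elt x -> idempotent_elt (coef0 x).
Proof.
by rewrite /idempotent_elt /coef0 => xx; rewrite -coefsM0 -rmorphM xx.
Qed.

Lemma iota_idempotent e : idempotent_elt e -> idempotent_elt (iota e).
Proof.
move=> ee; apply: phi_inj; rewrite rmorphM phi_iota.
exact: skew_const_idempotent.
Qed.

(** Constant [s] isolate the coefficients of [x]. Conversely, each summand of a coefficient of the
    product has the form [e * a * iter i alpha b] with [e * a * b = 0], so compatibility kills
    it. *)
Lemma annihilator_iota e x :
  (forall s, iota e * s * x = 0) <->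
  (forall n a, e * a * coefs (phi x) n = 0).
Proof.
split=> [ann n a|ann s].
  have /(congr1 phi) := ann (iota a).
  rewrite !rmorphM rmorph0 !phi_iota -mulrA => /(congr1 (fun f => coefs f n)).
  by rewrite !coefs_constM mulrA.
apply: phi_inj; rewrite -mulrA !rmorphM rmorph0 phi_iota.
apply: skew_seriesP => n; rewrite coefs_constM coefsM.
rewrite big_distrr big1 //= => i _.
by rewrite mulrA; apply: compatible_iter; apply: ann.
Qed.

Lemma annihilator_coef0_sub x y z : idempotent_elt x -> idempotent_elt y ->
  coef0 x = coef0 y -> (forall s, x * s * z = 0) -> forall s, y * s * z = 0.
Proof.
move=> xx yy xy0; apply: annihilator_idempotent_sub => // b.
move=> /(congr1 phi); rewrite rmorphM rmorph0 => /skew_series_lregular b0.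
apply: phi_inj; rewrite rmorph0 b0 // rmorphD !rmorphM !rmorphB rmorph1.
(* With [e] the common constant term, the multiplier has constant term
   [e * e + (1 - e) * (1 - e) = 1]. *)
rewrite coefsD !coefsM0 !coefsD !coefsN coefs1 -/(coef0 x) -/(coef0 y) /= -xy0.
have ee := coef0_idempotent xx.
by rewrite mulrBr mulr1 mulrBl mul1r ee subrr subr0 addrC subrK.
Qed.

Lemma coef0_iota e : coef0 (iota e) = e.
Proof. by rewrite /coef0 phi_iota. Qed.

Lemma right_cP_Baer_intermediate : right_cP_Baer R <-> right_cP_Baer A.
Proof.
rewrite !right_cP_BaerP; split=> baer e ee.
  have ee0 := coef0_idempotent ee; have [c cc annc] := baer _ ee0.
  exists (iota c) => [|x]; first exact: iota_idempotent.
  have iotae0 := iota_idempotent ee0.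
  have e0E := coef0_iota (coef0 e).
  have -> : (forall s, e * s * x = 0) <->
      (forall s, iota (coef0 e) * s * x = 0).
    by split; apply: annihilator_coef0_sub.
  rewrite annihilator_iota; split=> [ann|cx n].
    apply: phi_inj; rewrite rmorphM phi_iota; apply: skew_seriesP => n.
    by rewrite coefs_constM; apply/annc.
  by apply/annc; rewrite -coefs_constM -phi_iota -rmorphM cx.
have [c cc annc] := baer _ (iota_idempotent ee).
exists (coef0 c) => [|a]; first exact: coef0_idempotent.
split=> [ann|<- s].
  (* The coefficients of [iota a] are [a] and zeros, so [c] fixes [iota a]; then compare constant
     terms. *)
  have /annc/(congr1 coef0) : forall s, iota e * s * iota a = 0.
    apply/annihilator_iota => n b; rewrite phi_iota /=.
    by case: ifP; rewrite ?mulr0.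
  by rewrite /coef0 rmorphM coefsM0 -!/(coef0 _) coef0_iota.
(* [c * c = c] puts [c] itself in the annihilator, hence also its coefficient of index 0. *)
have /annc/annihilator_iota ann_c := cc.
by rewrite mulrA ann_c mul0r.
Qed.

End IntermediateRing.

End SkewSeries.

Theorem theorem2p8 (R : pzRingType) (alpha : {rmorphism R -> R})
    (alpha_compat : compatible alpha) :
  (right_cP_Baer R <-> right_cP_Baer (skew_poly alpha)) /\
  (right_cP_Baer R <-> right_cP_Baer (skew_series alpha)).
Proof.
split.
  pose iota a := SkewPoly (skew_const_poly alpha a).
  exact: (right_cP_Baer_intermediate alpha_compat
    (phi := (val : {rmorphism skew_poly alpha -> skew_series alpha}))
    (iota := iota) val_inj (fun=> erefl)).
apply: (@right_cP_Baer_intermediate R alpha alpha_compat (skew_series alpha)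
  idfun (skew_const alpha)) => //; exact: inj_id.
Qed.
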